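(* Under the assumption $\mathfrak d=\mathfrak c$, no product (with the product topology, over a nonempty index set) of infinite compact $\beta\omega$-spaces is homogeneous.
   Context: All spaces are completely regular Hausdorff topological spaces. $\mathfrak c=2^{\omega}$, and $\mathfrak d$ is the dominating number, that is, the smallest cardinality of a family $\mathscr D$ of functions $\omega\to\omega$ such that for every $f\colon\omega\to\omega$ there is a $g\in\mathscr D$ with $g(n)\ge f(n)$ for all but finitely many $n$. A set is called discrete if it is discrete in the subspace topology (not necessarily closed). A space $X$ is a $\beta\omega$-space if, whenever $D$ is a countable discrete subset of $X$ with compact closure $\overline D$ in $X$, this closure $\overline D$ is the Stone–Čech compactification $\beta D$ of $D$. A space $X$ is homogeneous if for any $x,y\in X$ there is a homeomorphism of $X$ onto itself taking $x$ to $y$. *)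

(* Defs.v *)
From HB Require Import structures.
From mathcomp Require Import all_boot all_order all_algebra.
From mathcomp Require Import all_classical all_reals all_analysis.

Set Implicit Arguments.
Unset Strict Implicit.
Unset Printing Implicit Defensive.

Local Open Scope classical_set_scope.
Local Open Scope card_scope.

Definition dominating_family (F : set (nat -> nat)) : Prop :=
  forall f : nat -> nat, exists2 g : nat -> nat, F g &
    cofinite_set [set n | (f n <= g n)%N].

(* [A] has cardinality d, the least cardinality of a dominating family;
   cardinals are represented by sets up to [#=]. *)
Definition has_dominating_number (T : Type) (A : set T) : Prop :=
  (exists2 F, dominating_family F & F #= A) /\
  (forall F, dominating_family F -> A #<= F).

Definition d_eq_c : Prop := has_dominating_number [set: nat -> bool].

Definition tychonoff_space (X : topologicalType) : Prop :=
  completely_regular_space X /\ hausdorff_space X.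

Definition embedding (X Y : topologicalType) (e : X -> Y) : Prop :=
  [/\ injective e, continuous e &
      forall A : set X, open A -> exists2 B : set Y, open B & e @^-1` B = A].

(* Uniqueness of the extension [g] is automatic, [range e] being dense and [L]
   Hausdorff. *)
Definition is_stone_cech (X K : topologicalType) (e : X -> K) : Prop :=
  [/\ compact [set: K], hausdorff_space K, embedding e, dense (range e) &
      forall (L : topologicalType) (f : X -> L),
        compact [set: L] -> hausdorff_space L -> continuous f ->
        exists2 g : K -> L, continuous g & g \o e = f].

(* Here and below a set used as a type carries the subspace topology. *)
Definition discrete_subset (X : topologicalType) (D : set X) : Prop :=
  forall A : set (set_type D), open A.

(* [subfun (@subset_closure X D)] is the inclusion of [D] in its closure. *)
Definition beta_omega_space (X : topologicalType) : Prop :=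
  forall D : set X, countable D -> discrete_subset D -> compact (closure D) ->
    @is_stone_cech (set_type D) (set_type (closure D))
      (subfun (@subset_closure X D)).

Definition homeomorphism (X Y : topologicalType) (f : X -> Y) : Prop :=
  continuous f /\
  exists g : Y -> X, [/\ continuous g, cancel f g & cancel g f].

Definition homogeneous_space (X : topologicalType) : Prop :=
  forall x y : X, exists2 h : X -> X, homeomorphism h & h x = y.

(* Main.v *)
Require Import Defs.
From mathcomp Require Import all_boot all_order all_algebra.
From mathcomp Require Import all_classical all_reals all_analysis.
From mathcomp Require Import wochoice.

(** Under [d = c], Ketonen's construction yields a P-point [q] on [nat * nat]
    all of whose members have unboundedly many points in unboundedly many
    columns, so that [fst] is injective on no member of [q] and [q] is not
    Rudin-Keisler below [p := fst @ q]. Let [y] have all its coordinates of the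
    form [lim_q d_t] with [d] injective. In a compact beta-omega-space, a
    sequence with [p]-limit [lim_q d_t] must then be equal to its limit on a set
    of [p]. Let [x] be the [p]-limit of [e_m], whose coordinates run through
    discrete sequences, and let [h] be a homeomorphism of the product with
    [h x = y]. Each coordinate of [v_m := h e_m] is thus equal to that of [y]
    for [p]-many [m]. Let [u_mk] agree with [v_m] where [v_m] differs from [y],
    and with [v_k] elsewhere: a fixed coordinate of [h^-1 u_mk] has [p]-limit
    that of [e_m] as [k] varies and that of [e_k] as [m] varies, while its
    iterated limits agree. Along a suitable subsequence this produces two
    disjoint parts of a countable discrete set whose closures meet. *)

Set Implicit Arguments.
Unset Strict Implicit.
Unset Printing Implicit Defensive.
Local Open Scope classical_set_scope.
Local Open Scope card_scope.

(** * Limits along ultrafilters and beta-omega-spaces *)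

Lemma ultra_cvg_compact (T : Type) (U : set_system T) (Y : topologicalType)
    (f : T -> Y) :
  UltraFilter U -> compact [set: Y] -> exists y : Y, f @ U --> y.
Proof.
move=> UU cY; have [y [_ cly]] :=
  cY (f @ U) (fmap_proper_filter f _) (@filterT _ U _).
exists y => A nA.
have [//|UC] := in_ultra_setVsetC (f @^-1` A) UU.
by have [z [nz Az]] := cly (~` A) A UC nA.
Qed.

Lemma cvg_prodP (I : Type) (K : I -> topologicalType) (T : Type)
    (F : set_system T) (f : T -> prod_topology K) (l : prod_topology K) :
  Filter F -> f @ F --> l <-> forall i, (fun t => f t i) @ F --> l i.
Proof.
move=> FF; split=> [/cvg_sup fl i A | fl].
  move=> nA; apply: (fl i ((fun h : forall j, K j => h i) @^-1` A)).
  move: nA; rewrite !nbhsE => -[B [oB Bl] BA].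
  exists ((fun h : forall j, K j => h i) @^-1` B); last by move=> h /BA.
  by split=> //; exists B.
apply/cvg_sup => i A; rewrite nbhsE => -[B [[C oC <-] Bl] BA].
have FC : F [set t | C (f t i)] by exact: fl (open_nbhs_nbhs (conj oC Bl)).
by apply: (@filterS _ F _ _ (f @^-1` A) _ FC) => t; exact: BA.
Qed.

Lemma near_cst_cvg (T : Type) (F : set_system T) (Y : topologicalType)
    (f : T -> Y) (y : Y) :
  Filter F -> F [set t | f t = y] -> f @ F --> y.
Proof.
move=> FF Fy A /nbhs_singleton Ay.
by apply: (@filterS _ F _ _ (f @^-1` A) _ Fy) => t /= ->.
Qed.

Lemma cvg_eq_near (T : Type) (F : set_system T) (Y : topologicalType)
    (f g : T -> Y) (y : Y) :
  Filter F -> F [set t | f t = g t] -> g @ F --> y -> f @ F --> y.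
Proof.
move=> FF Fe gy A nA; have FgA : F (g @^-1` A) := gy A nA.
apply: (@filterS _ F _ _ (f @^-1` A) _ (filterI Fe FgA)).
by move=> t [/= ->].
Qed.

Lemma cvg_closure (T : Type) (F : set_system T) (Y : topologicalType)
    (f : T -> Y) (y : Y) (Q : set T) :
  ProperFilter F -> F Q -> f @ F --> y -> closure (f @` Q) y.
Proof.
move=> FF FQ fy A nA; have FA : F (f @^-1` A) := fy A nA.
have [t [Qt At]] := filter_ex (filterI FQ FA).
by exists (f t); split=> //; exists t.
Qed.

Lemma open_separation (X : topologicalType) (x y : X) :
  hausdorff_space X -> x <> y ->
  exists U V, [/\ open U, open V, U x, V y & U `&` V = set0].
Proof.
rewrite open_hausdorff => hX /eqP /hX [[U V] /= [/set_mem Ux /set_mem Vy]].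
by move=> [oU oV /eqP UV]; exists U, V.
Qed.

Lemma compact_shrink_open (X : topologicalType) (x : X) (U : set X) :
  compact [set: X] -> hausdorff_space X -> open U -> U x ->
  exists2 V, open_nbhs x V & closure V `<=` U.
Proof.
move=> cX hX oU Ux.
have [V nV VU] : filter_from (nbhs x) closure U.
  by apply: (compact_regular hX cX filterT); exact: open_nbhs_nbhs.
move: nV; rewrite nbhsE => -[W oW WV]; exists W => //.
exact: subset_trans (closureS WV) VU.
Qed.

Lemma isolated_discrete_subset (X : topologicalType) (D : set X) :
  (forall x, D x -> exists2 V, open_nbhs x V & V `&` D `<=` [set x]) ->
  discrete_subset D.
Proof.
move=> iD A; rewrite openE => a Aa.
have [V [oV Va] VD] := iD (val a) (set_valP a).
rewrite /interior nbhsE; exists (set_val @^-1` V).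
  by split=> //; exists V.
move=> b /= Vb; have ba : b = a; last by rewrite ba.
by apply: val_inj; apply: VD; split=> //; exact: set_valP.
Qed.

(** On the discrete union of [A] and [B] the indicator of [A] is continuous; a continuous extension
    of it to the closure is locally constant, so it separates the two closures. *)
Lemma beta_omega_disjoint_closures (X : topologicalType) (A B : set X) :
  beta_omega_space X -> compact [set: X] ->
  countable (A `|` B) -> discrete_subset (A `|` B) ->
  A `&` B = set0 -> closure A `&` closure B = set0.
Proof.
move=> bX cX cD dD AB0; set D := A `|` B in cD dD.
have cclD : compact (closure D).
  by apply: (@subclosed_compact _ _ [set: X]) => //; exact: closed_closure.
have [_ _ _ _ ext] := bX D cD dD cclD.
pose f (x : set_type D) : bool := `[< A (val x) >].
have [g cg gf] : exists2 g : set_type (closure D) -> bool, continuous g &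
    g \o subfun (@subset_closure X D) = f.
  apply: ext; [exact: bool_compact|exact: discrete_hausdorff|].
  move=> x S nS; apply: (@open_nbhs_nbhs _ _ (f @^-1` S)).
  by split; [exact: dD|exact: nbhs_singleton nS].
have val_g (x : X) (clx : closure D x) (Dx : D x) :
    g (SigSub (mem_set clx)) = `[< A x >].
  have := congr1 (@^~ (SigSub (mem_set Dx) : set_type D)) gf.
  rewrite /f /= => <-; congr g; exact: val_inj.
apply/seteqP; split=> // y [yA yB].
have yD : closure D y by move: yA; apply: closureS; left.
pose y' : set_type (closure D) := SigSub (mem_set yD).
have : nbhs y' (g @^-1` [set g y']) by apply: cg; exact: discrete_set1.
rewrite nbhsE => -[_ [[V oV <-] Vy'] sV].
have nV : nbhs y V by exact: open_nbhs_nbhs.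
have [a [Aa Va]] := yA _ nV; have [b [Bb Vb]] := yB _ nV.
have ca : closure D a by apply: subset_closure; left.
have cb : closure D b by apply: subset_closure; right.
have gA := sV (SigSub (mem_set ca)) Va.
have gB := sV (SigSub (mem_set cb)) Vb.
have {gA} gA : `[< A a >] = g y' by rewrite -gA (val_g _ ca (or_introl Aa)).
have {gB} gB : `[< A b >] = g y' by rewrite -gB (val_g _ cb (or_intror Bb)).
have Ab : A b by apply/asboolP; rewrite gB -gA; exact/asboolP.
by have : (A `&` B) b by []; rewrite AB0.
Qed.

Lemma hausdorff_finite_closed (X : topologicalType) (F : set X) :
  hausdorff_space X -> finite_set F -> closed F.
Proof.
move=> /hausdorff_accessible aX.
exact: (proj1 (@accessible_finite_set_closed X) aX).
Qed.

(** Separate two points of [U] by disjoint open sets [A] and [B]. If [U] minus the closure of its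
    part in [A] is finite, then its part in [B] is finite, hence closed, and can be cut off
    instead. *)
Lemma infinite_open_split (X : topologicalType) (U : set X) :
  hausdorff_space X -> open U -> infinite_set U ->
  exists x V, [/\ open_nbhs x V, V `<=` U & infinite_set (U `\` closure V)].
Proof.
move=> hX oU iU; have [a Ua] := infinite_setN0 iU.
have [b [Ub ba]] := infinite_setN0 (infinite_setD iU (finite_set1 a)).
have [A [B [oA oB Aa Bb AB]]] := open_separation hX (not_eq_sym ba : a <> b).
have [fA|iA] := pselect (finite_set (U `\` closure (A `&` U))); last first.
  by exists a, (A `&` U); split=> //; split; [exact: openI|].
have fB : finite_set (B `&` U).
  apply: sub_finite_set fA => x [Bx Ux]; split=> // /(_ B).
  case; first exact: open_nbhs_nbhs.
  by move=> z [[Az _] Bz]; have : (A `&` B) z by []; rewrite AB.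
have cB : closed (B `&` U).
  by apply: hausdorff_finite_closed.
exists b, (B `&` U); split=> //; first by split; [exact: openI|].
by rewrite -(proj1 (closure_id _) cB); exact: infinite_setD.
Qed.

(** The split is iterated on what remains of the space outside the closures of the earlier
    neighbourhoods. *)
Lemma infinite_disjoint_opens (X : topologicalType) :
  hausdorff_space X -> infinite_set [set: X] ->
  exists (d : nat -> X) (W : nat -> set X),
    (forall n, open_nbhs (d n) (W n)) /\
    (forall m n, m <> n -> W m `&` W n = set0).
Proof.
move=> hX iX; pose St := {U : set X | open U /\ infinite_set U}.
have step (U : St) : exists xV : X * set X, [/\ open_nbhs xV.1 xV.2,
    xV.2 `<=` sval U & infinite_set (sval U `\` closure xV.2)].
  case: U => U [oU iU].
  by have [x [V]] := infinite_open_split hX oU iU; exists (x, V).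
have [f fP] := choice step.
have nextP (U : St) : open (sval U `\` closure (f U).2) /\
    infinite_set (sval U `\` closure (f U).2).
  have [_ _ iUV] := fP U; split=> //.
  by rewrite setDE; apply: openI; [case: (svalP U)
    |apply: closed_openC; exact: closed_closure].
pose next U : St := exist _ _ (nextP U).
pose s n : St := iter n next (exist _ [set: X] (conj openT iX)).
have s_decr m n : (m <= n)%N -> sval (s n) `<=` sval (s m).
  elim: n => [|n IH]; first by rewrite leqn0 => /eqP ->.
  by rewrite leq_eqVlt => /orP[/eqP -> //|/IH]; apply: subset_trans => x [].
have W_disj m n : (m < n)%N -> (f (s m)).2 `&` (f (s n)).2 = set0.
  move=> mn; apply/seteqP; split=> // x [xm xn].
  have [_ /(_ _ xn) /(s_decr _ _ mn) [_ +] _] := fP (s n).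
  by apply; exact: subset_closure.
exists (fun n => (f (s n)).1), (fun n => (f (s n)).2); split.
  by move=> n; case: (fP (s n)).
move=> m n /eqP; rewrite neq_ltn => /orP[|] mn; first exact: W_disj.
by rewrite setIC; exact: W_disj.
Qed.

Definition p_point (T : Type) (q : set_system T) : Prop :=
  forall A : nat -> set T, (forall n, q (A n)) ->
    exists2 B, q B & forall n, finite_set (B `\` A n).

Lemma p_point_countType (T : Type) (q : set_system T) (I : countType)
    (A : I -> set T) :
  Filter q -> p_point q -> (forall i, q (A i)) ->
  exists2 B, q B & forall i, finite_set (B `\` A i).
Proof.
move=> Fq qP qA; pose A' n := if unpickle n is Some i then A i else setT.
have [|B qB BA] := qP A'.
  by move=> n; rewrite /A'; case: unpickle => [i|]; [|exact: filterT].
by exists B => // i; have := BA (pickle i); rewrite /A' pickleK.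
Qed.

(* If [d] converges to [y] along [q], then [v \o pi] can only do so by being
   equal to [y] on a set of [q]: otherwise, on some [Q] in [q], the values of
   [d] and of [v \o pi] form a discrete set, of which they are disjoint parts
   having [y] in both closures. *)
Lemma p_point_cvg_eq_limit (T : countType) (q : set_system T)
    (pi : T -> nat) (Y : topologicalType) (d : T -> Y) (v : nat -> Y) (y : Y) :
  UltraFilter q -> p_point q -> (forall t, ~ q [set t]) ->
  (forall R : nat -> T -> Prop,
    (forall m s s', R m s -> R m s' -> s = s') ->
    exists2 Q, q Q & forall t s, Q t -> Q s -> ~ R (pi t) s) ->
  hausdorff_space Y -> compact [set: Y] -> beta_omega_space Y ->
  injective d -> d @ q --> y -> (v \o pi) @ q --> y ->
  q [set t | v (pi t) = y].
Proof.
move=> Uq qP q1 qR hY cY bY d_inj dy vy.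
have [//|vNy] := in_ultra_setVsetC [set t | v (pi t) = y] Uq.
have dNy : q [set t | d t <> y].
  have [[t0 dt0]|Nd] := pselect (exists t, d t = y); last first.
    by apply: (@filterS _ q _ setT) => [t _ dt|]; [apply: Nd; exists t
      |exact: filterT].
  have [/q1//|] := in_ultra_setVsetC [set t0] Uq.
  by apply: filterS => t /= tt0 dt; apply: tt0; apply: d_inj; rewrite dt0.
have sep (e : Y) : exists NM : set Y * set Y, e <> y ->
    [/\ open_nbhs y NM.1, open_nbhs e NM.2 & NM.1 `&` NM.2 = set0].
  have [ey|/(open_separation hY)] := pselect (e = y).
    by exists (set0, set0) => /(_ ey).
  by move=> [U [V [oU oV Ue Vy UV]]]; exists (V, U) => _; rewrite setIC.
have [NM NMP] := choice sep.
(* The indices at which both sequences are in a neighbourhood of [y] that misses a neighbourhood of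
   [e]. *)
pose A e := [set s | e <> y -> (NM e).1 (d s) /\ (NM e).1 (v (pi s))].
have qA e : q (A e).
  have [->|ey] := pselect (e = y); first by apply: filterS filterT => ? _.
  have [/open_nbhs_nbhs nN _ _] := NMP e ey.
  have dN : q [set s | (NM e).1 (d s)] := dy _ nN.
  have vN : q [set s | (NM e).1 (v (pi s))] := vy _ nN.
  by apply: (@filterS _ q _ _ (A e) _ (filterI dN vN)) => s [].
have [B qB BA] := p_point_countType _ qP
  (fun t => filterI (qA (d t)) (qA (v (pi t)))).
(* The relation [v m = d s] determines [s] from [m], so on some [Q] in [q] no value of [v \o pi] is
   a value of [d]. *)
have [m s s' -> /d_inj //|Q qQ QR] := qR (fun m s => v m = d s).
pose C := B `&` (Q `&` ([set t | d t <> y] `&` ~` [set t | v (pi t) = y])).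
have qC : q C by do 3!apply: filterI => //.
pose D1 := d @` C; pose D2 := (v \o pi) @` C.
have D12 : D1 `&` D2 = set0.
  apply/seteqP; split=> // _ [[s [_ [Qs _]] <-] [t [_ [Qt _]]]].
  exact: QR.
have cE : countable (D1 `|` D2).
  rewrite -bigcup2E; apply: bigcup_countable => // -[|[|n]] _ //=;
    exact: sub_countable (card_image_le _ _) (countableP _).
have dE : discrete_subset (D1 `|` D2).
  apply: isolated_discrete_subset => e eE.
  have [ey fe] : e <> y /\ finite_set (B `\` A e).
    case: eE => -[t [_ [_ [dt vt]]] <-]; split=> //.
      by apply: sub_finite_set (BA t) => s [Bs nA]; split=> // -[].
    by apply: sub_finite_set (BA t) => s [Bs nA]; split=> // -[].
  have [oN [oM Me] NM0] := NMP e ey.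
  (* The finitely many values other than [e] that may fall outside the chosen neighbourhood of [y];
     removing them from the neighbourhood of [e] isolates [e]. *)
  pose F := (d @` (B `\` A e) `|` (v \o pi) @` (B `\` A e)) `\` [set e].
  have fF : finite_set F.
    by apply: finite_setD; rewrite finite_setU; split; exact: finite_image.
  have cF : closed F.
    by apply: hausdorff_finite_closed.
  exists ((NM e).2 `\` F).
    split; last by split=> // -[_]; apply.
    by rewrite setDE; apply: openI => //; exact: closed_openC.
  move=> z [[Mz nF] zE]; apply: contrapT => ze; apply: nF; split=> //.
  case: zE => -[t [Bt _] tz]; [left|right]; exists t => //; split=> // At.
    have [Nz _] := At ey; rewrite tz in Nz.
    by have : ((NM e).1 `&` (NM e).2) z by []; rewrite NM0.
  have [_ Nz] := At ey; rewrite /= in tz; rewrite tz in Nz.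
  by have : ((NM e).1 `&` (NM e).2) z by []; rewrite NM0.
have := beta_omega_disjoint_closures bY cY cE dE D12.
have : (closure D1 `&` closure D2) y by split; exact: cvg_closure qC _.
by move=> + cl0; rewrite cl0.
Qed.

(** * Subsets of [nat * nat] with big columns *)

(** The positive sets of the ideal ED, which is generated by the columns and the graphs of
    functions. *)
Definition column_big (X : set (nat * nat)) : Prop :=
  forall k, exists2 l, (k <= l)%N & exists s : seq nat,
    [/\ uniq s, (k <= size s)%N & forall i, i \in s -> X (l, i)].

Lemma column_bigS (X Y : set (nat * nat)) :
  X `<=` Y -> column_big X -> column_big Y.
Proof.
move=> XY bX k; have [l kl [s [us ks sX]]] := bX k.
by exists l => //; exists s; split=> // i /sX /XY.
Qed.

Lemma column_bigT : column_big [set: nat * nat].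
Proof.
by move=> k; exists k => //; exists (iota 0 k); rewrite iota_uniq size_iota.
Qed.

(** A column with [k + k'] points of the union has [k] points in [X] or [k'] points in [Y]. *)
Lemma column_bigU (X Y : set (nat * nat)) :
  column_big (X `|` Y) -> column_big X \/ column_big Y.
Proof.
move=> bXY; apply: contrapT => /not_orP [].
move=> /existsNP [k Xk] /existsNP [k' Yk'].
have [l kl [s [us ks sXY]]] := bXY (k + k')%N.
have := count_predC (fun i => `[< X (l, i) >]) s.
rewrite -!size_filter => szs.
have [kX|Xk1] := leqP k (size [seq i <- s | `[< X (l, i) >]]).
  apply: Xk; exists l; first exact: leq_trans (leq_addr _ _) kl.
  exists [seq i <- s | `[< X (l, i) >]]; split=> //; first exact: filter_uniq.
  by move=> i; rewrite mem_filter => /andP[/asboolP].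
apply: Yk'; exists l; first exact: leq_trans (leq_addl _ _) kl.
exists [seq i <- s | predC (fun i => `[< X (l, i) >]) i]; split=> //.
- exact: filter_uniq.
- rewrite leqNgt; apply/negP => lt2.
  have := leq_trans ks (eq_leq (esym szs)).
  by rewrite leqNgt -addnS leq_add // ltnW.
- move=> i; rewrite mem_filter => /andP[/= /asboolPn nX /sXY] [] //.
Qed.

Lemma column_big_fst_ge (X : set (nat * nat)) :
  column_big X -> forall N, exists2 t, X t & (N <= t.1)%N.
Proof.
move=> bX N; have [l Nl [[|i s] [_ + sX]]] := bX N.+1; first by rewrite ltn0.
by exists (l, i); [apply: sX; rewrite mem_head|exact: ltnW].
Qed.

Lemma graph_not_column_big (X : set (nat * nat)) :
  (forall l i j, X (l, i) -> X (l, j) -> i = j) -> ~ column_big X.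
Proof.
move=> fX /(_ 2%N) [l _ [[|i [|j s]] [us // _ sX]]].
have ij : i = j by apply: (fX l); apply: sX; rewrite !inE eqxx ?orbT.
by move: us; rewrite ij /= mem_head.
Qed.

(** The colour of [m] is the parity of the number of applications of [g] that lead out of [P]; [mu]
    bounds this number. *)
Lemma alternating_coloring (P : pred nat) (g mu : nat -> nat) :
  (forall m, P m -> (mu (g m) < mu m)%N) ->
  exists c : nat -> bool, forall m, P m -> c (g m) = ~~ c m.
Proof.
move=> g_decr.
(* Here [n] is fuel: any amount above [mu m] gives the same colour. *)
pose col := fix col n m :=
  if n is n'.+1 then if P m then ~~ col n' (g m) else false else false.
have colE n n' m : (mu m < n)%N -> (mu m < n')%N -> col n m = col n' m.
  elim: n n' m => [|n IH] [|n'] m //= mn mn'.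
  case: ifP => // /g_decr gm; congr (~~ _).
  by apply: IH; [exact: leq_trans gm mn|exact: leq_trans gm mn'].
exists (fun m => col (mu m).+1 m) => m Pm.
have -> : col (mu m).+1 m = ~~ col (mu m) (g m) by rewrite /= Pm.
by rewrite negbK; apply: colE => //; exact: g_decr.
Qed.

(* Katetov's colouring argument, for maps of the form [g \o fst]. *)
Lemma column_big_ultra_avoid (q : set_system (nat * nat))
    (R : nat -> nat * nat -> Prop) :
  UltraFilter q -> (forall X, q X -> column_big X) ->
  (forall m s s', R m s -> R m s' -> s = s') ->
  exists2 Q, q Q & forall t s, Q t -> Q s -> ~ R t.1 s.
Proof.
move=> Uq qbig Rfun.
(* [g m] is the column that [R m] points to, with default 0. *)
have /choice[g gR] (m : nat) : exists a, forall s, R m s -> s.1 = a.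
  have [[s Rms]|nR] := pselect (exists s, R m s).
    by exists s.1 => s' /(Rfun _ _ _ Rms) ->.
  by exists 0%N => s Rms; case: nR; exists s.
(* It suffices to colour the columns so that [R] changes the colour on a member of [q]: one colour
   class is in [q]. *)
have q_color (c : nat -> bool) (Q : set (nat * nat)) : q Q ->
    (forall t s, Q t -> Q s -> R t.1 s -> c s.1 <> c t.1) ->
    exists2 Q, q Q & forall t s, Q t -> Q s -> ~ R t.1 s.
  move=> qQ cQ.
  have [b qb] : exists b, q [set t | c t.1 = b].
    have [|qc] := in_ultra_setVsetC [set t | c t.1 = true] Uq.
      by exists true.
    by exists false; apply: filterS qc => t /negP/negbTE.
  exists (Q `&` [set t | c t.1 = b]); first exact: filterI.
  by move=> t s [Qt ct] [Qs cs] /(cQ _ _ Qt Qs); rewrite ct cs.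
have [qlt|qge] := in_ultra_setVsetC [set t | (g t.1 < t.1)%N] Uq.
  have [//|c cP] := @alternating_coloring (fun m => (g m < m)%N) g id.
  apply: (q_color c _ qlt) => t s tlt _ /gR ->.
  by rewrite (cP _ tlt); case: (c _).
have [qgt|qle] := in_ultra_setVsetC [set t | (t.1 < g t.1)%N] Uq.
  (* Colour the finite initial segments and take the limit along [q]. *)
  have /choice[c cP] (n : nat) : exists c : nat -> bool,
      forall m, (m < g m <= n)%N -> c (g m) = ~~ c m.
    apply: (@alternating_coloring _ g (fun m => n - m)%N) => m /andP[mg gn].
    exact: ltn_sub2l (leq_trans mg gn) mg.
  pose clim m := `[< q [set t | c t.1 m = true] >].
  apply: (q_color clim _ qgt) => t s tg _ /gR ->.
  have qn : q [set r | (g t.1 <= r.1)%N].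
    have [//|/qbig /column_big_fst_ge /(_ (g t.1)) [r]] :=
      in_ultra_setVsetC [set r | (g t.1 <= r.1)%N] Uq.
    by [].
  rewrite /clim.
  have [qc|qc] := in_ultra_setVsetC [set r | c r.1 t.1 = true] Uq.
    rewrite (asboolT qc) asboolF // => qc'.
    have [r [[/= r1 r2] r3]] := filter_ex (filterI (filterI qc qc') qn).
    by move: r2; rewrite cP ?r1 // tg.
  have nq : ~ q [set r | c r.1 t.1 = true].
    by move=> qc'; have [r []] := filter_ex (filterI qc qc').
  have qg : q [set r | c r.1 (g t.1) = true].
    apply: filterS (filterI qc qn) => r [/= /negP cr gr].
    by rewrite cP ?tg // (negbTE cr).
  by rewrite (asboolF nq) (asboolT qg).
(* In the last case [R] stays within the column. The points related to their own column form a
   graph, so they can be discarded. *)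
pose Q := [set t | g t.1 = t.1] `&` [set t | ~ R t.1 t].
exists Q.
  apply: filterI.
    apply: filterS (filterI qge qle) => t [/= /negP + /negP].
    by rewrite -!leqNgt => tg gt; apply/eqP; rewrite eqn_leq tg gt.
  have [/qbig|//] := in_ultra_setVsetC [set t | R t.1 t] Uq.
  move=> /graph_not_column_big [] l i j /= Ri Rj.
  by have [] := Rfun _ _ _ Ri Rj.
move=> t s [/= gt _] [/= gs nR] Rts; apply: nR.
by rewrite (gR _ _ Rts) gt.
Qed.

(** * Ketonen's construction *)

(** For each [j] and [n], bound a witness that [F j] meets [A n] in a column with [n] points. Some
    [g] is dominated by none of these bounds. Keeping only a box of size [g n] from each [A n] makes
    [S] almost contained in every [A n], yet retains infinitely many witnesses for each [j]. *)
Lemma column_big_pseudo_intersection (J : Type) (F : J -> set (nat * nat))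
    (A : nat -> set (nat * nat)) :
  (forall f : J -> nat -> nat, ~ dominating_family (range f)) ->
  (forall m n, (m <= n)%N -> A n `<=` A m) ->
  (forall j n, column_big (F j `&` A n)) ->
  exists S, (forall n, finite_set (S `\` A n)) /\
            (forall j, column_big (F j `&` S)).
Proof.
move=> ndom Adecr bigFA.
have bound (x : J * nat) : exists b, exists2 l, (x.2 <= l < b)%N &
    exists s : seq nat, [/\ uniq s, (x.2 <= size s)%N &
      forall i, i \in s -> (i < b)%N /\ (F x.1 `&` A x.2) (l, i)].
  have [l nl [s [us ns sFA]]] := bigFA x.1 x.2 x.2.
  exists (maxn l.+1 (\max_(i <- s) i).+1); exists l.
    by rewrite nl leq_maxl.
  exists s; split=> // i si; split; last exact: sFA.
  rewrite leq_max ltnS; apply/orP; right.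
  by rewrite ltnS (big_rem i si) /= leq_maxl.
have [f fP] := choice bound.
have /existsNP [g gP] := ndom (fun j n => f (j, n)).
pose S := [set t | exists n,
  [/\ A n t, (n <= t.1)%N, (t.1 < g n)%N & (t.2 < g n)%N]].
exists S; split=> [n|j k].
  pose N := \max_(i < n) g i.
  apply: (@sub_finite_set _ _ (`I_N `*` `I_N)).
    move=> t [[m [Am _ t1 t2]] nAn].
    have mn : (m < n)%N.
      by rewrite ltnNge; apply/negP => /Adecr; apply: contra_not nAn; apply.
    have gN : (g m <= N)%N by exact: (leq_bigmax (Ordinal mn)).
    by split; apply: leq_trans gN.
  by apply: finite_setX; exact: finite_II.
have [n kn fg] : exists2 n, (k <= n)%N & (f (j, n) < g n)%N.
  apply: contrapT => nfg; apply: gP; exists (fun n => f (j, n)).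
    by exists j.
  apply: (@sub_finite_set _ _ `I_k); last exact: finite_II.
  move=> n /= /negP; rewrite -ltnNge => fg; rewrite ltnNge; apply/negP => kn.
  by apply: nfg; exists n.
have [l /andP[nl lf] [s [us ns sFA]]] := fP (j, n).
exists l; first exact: leq_trans kn nl.
exists s; split=> //; first exact: leq_trans kn ns.
move=> i /sFA [ib [Fi Ai]]; split=> //; exists n; split=> //=.
  exact: ltn_trans lf fg.
exact: ltn_trans ib fg.
Qed.

Lemma exists_max_seq (K : eqType) (lt : K -> K -> Prop) (s : seq K) :
  (forall x y z, lt x y -> lt y z -> lt x z) ->
  (forall x y, [\/ lt x y, x = y | lt y x]) ->
  s <> [::] -> exists2 m, m \in s & forall i, i \in s -> lt i m \/ i = m.
Proof.
move=> tr tot; elim: s => // x [|y s] IH _.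
  by exists x; [rewrite mem_head|move=> i; rewrite inE => /eqP; right].
have [//|m ms mP] := IH _.
have [mx|mx|xm] := tot m x.
- exists x; first by rewrite mem_head.
  move=> i; rewrite inE => /orP[/eqP|/mP [im| ->]]; [by right| |by left].
  by left; exact: tr im mx.
- exists m; first by rewrite inE ms orbT.
  by move=> i; rewrite inE => /orP[/eqP ->|/mP]; [right|].
- exists m; first by rewrite inE ms orbT.
  by move=> i; rewrite inE => /orP[/eqP ->|/mP]; [left|].
Qed.

Definition seq_inter (K : eqType) (T : Type) (S : K -> set T) (s : seq K) :=
  [set t | forall i, i \in s -> S i t].

(** Stage [k] adds a pseudo-intersection of [task k] that keeps all finite intersections with
    earlier sets big, or the whole set if there is none. A decreasing sequence in the final
    ultrafilter is some task, and fewer than dominating many finite intersections precede it, so its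
    stage succeeds. *)
Lemma p_point_from_index (K : eqType) (lt : K -> K -> Prop)
    (task : K -> nat -> set (nat * nat)) :
  well_founded lt ->
  (forall x y z, lt x y -> lt y z -> lt x z) ->
  (forall x y, [\/ lt x y, x = y | lt y x]) ->
  (forall A, exists k, task k = A) ->
  (forall k (f : {s : seq K | forall i, i \in s -> lt i k} -> nat -> nat),
     ~ dominating_family (range f)) ->
  exists q : set_system (nat * nat),
    [/\ UltraFilter q, p_point q & forall X, q X -> column_big X].
Proof.
move=> wf tr tot task_surj ndom.
pose good k (G : K -> set (nat * nat)) := [set S |
  (forall n, finite_set (S `\` task k n)) /\
  forall s, (forall i, i \in s -> lt i k) -> column_big (seq_inter G s `&` S)].
have [S SE] : exists S : K -> set (nat * nat),
    forall k, S k = xget setT (good k S).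
  (* Values not yet defined are replaced by [setT]; sequences below [k] do not see the
     difference. *)
  pose ext k (r : forall k', lt k' k -> set (nat * nat)) k' :=
    if pselect (lt k' k) is left h then r k' h else setT.
  pose step k r := xget setT (good k (ext k r)).
  exists (Fix wf (fun=> set (nat * nat)) step) => k.
  rewrite Fix_eq => [|x f g fg]; last first.
    rewrite /step; congr (xget _ (good _ _)); apply/funext => k'.
    by rewrite /ext; case: pselect.
  rewrite /step; set G := Fix _ _ _; congr xget.
  have E s : (forall i, i \in s -> lt i k) ->
      seq_inter (ext k (fun y _ => G y)) s = seq_inter G s.
    move=> sk; apply/seteqP; split=> t tS i si; have := tS i si;
      by rewrite /ext; case: pselect => // nlt; case: nlt; exact: sk.
  by apply/seteqP; split=> X [finX bigX]; split=> // s sk;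
    have := bigX s sk; rewrite E.
(* Induction on [k]: a finite set of indices below [k] is handled at its maximum, and [S k] is
   compatible with it by choice. *)
have bigLe k s : (forall i, i \in s -> lt i k \/ i = k) ->
    column_big (seq_inter S s).
  elim/(well_founded_ind wf): k s => k IH s sk.
  have bigLt s' : (forall i, i \in s' -> lt i k) -> column_big (seq_inter S s').
    move=> s'k; have [->|s'0] := pselect (s' = [::]).
      by apply: column_bigS column_bigT => ? _ ?.
    have [m ms mP] := exists_max_seq tr tot s'0.
    by apply: (IH m) => //; exact: s'k.
  pose s' := [seq i <- s | i != k].
  have s'k i : i \in s' -> lt i k.
    by rewrite mem_filter => /andP[/eqP ik /sk []].
  have sub : seq_inter S s' `&` S k `<=` seq_inter S s.
    move=> t [ts' tk] i si; have [->//|ik] := eqVneq i k.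
    by apply: ts'; rewrite mem_filter ik.
  apply: column_bigS sub _.
  have [[X gX]|ng] := pselect (exists X, good k S X).
    have [_ bigS] := xgetPex setT (ex_intro _ X gX : exists X, good k S X).
    by rewrite SE; exact: bigS.
  rewrite SE xgetPN ?setIT; first exact: bigLt.
  by move=> X gX; apply: ng; exists X.
have bigI s : column_big (seq_inter S s).
  have [->|s0] := pselect (s = [::]).
    by apply: column_bigS column_bigT => ? _ ?.
  by have [m _ mP] := exists_max_seq tr tot s0; exact: (bigLe m).
(* The filter generated by the sets [S k] and the complements of the sets that are not big. *)
pose G := [set X | exists s, ~ column_big (seq_inter S s `\` X)].
have not_big0 : ~ column_big set0.
  move=> /(_ 1%N) [l _ [[|i s] [_ // _ /(_ i)]]].
  by rewrite mem_head => /(_ isT).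
have FG : ProperFilter G.
  apply: Build_ProperFilter.
    by move=> [s]; rewrite setD0.
  split.
  - by exists [::]; rewrite setDT.
  - move=> X Y [s sX] [s' sY]; exists (s ++ s') => bigXY.
    have /column_bigU [] : column_big
        ((seq_inter S s `\` X) `|` (seq_inter S s' `\` Y)).
    + apply: column_bigS bigXY => t [tss nXY].
      have ts : seq_inter S s t by move=> i si; apply: tss; rewrite mem_cat si.
      have ts' : seq_inter S s' t.
        by move=> i si; apply: tss; rewrite mem_cat si orbT.
      by have /not_andP [nX|nY] : ~ (X t /\ Y t) := nXY; [left|right].
    + by [].
    + by [].
  - move=> X Y XY [s sX]; exists s => bigY; apply: sX.
    by apply: column_bigS bigY => t [ts nY]; split=> // /XY.
have [q [Uq Gq]] := ultraFilterLemma FG.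
have qbig X : q X -> column_big X.
  move=> qX; apply: contrapT => nX.
  have qC : q (~` X).
    apply: Gq; exists [::]; apply: contra_not nX; apply: column_bigS => t [_].
    exact: contrapT.
  by have [t []] := filter_ex (filterI qX qC).
have qS k : q (S k).
  apply: Gq; exists [:: k]; apply: contra_not not_big0; apply: column_bigS.
  by move=> t [tk]; apply; apply: tk; rewrite mem_head.
have qI s : q (seq_inter S s).
  elim: s => [|i s IH]; first by apply: filterS filterT => ? _ ?.
  apply: filterS (filterI (qS i) IH) => t [ti ts] j.
  by rewrite inE => /orP[/eqP ->//|/ts].
exists q; split=> // A qA.
(* Decreasing version of [A], as required of the task. *)
pose A' n := [set t | forall m, (m <= n)%N -> A m t].
have qA' n : q (A' n).
  elim: n => [|n IH].
    by apply: filterS (qA 0%N) => t At m; rewrite leqn0 => /eqP ->.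
  apply: filterS (filterI (qA n.+1) IH) => t [At ts] m.
  by rewrite leq_eqVlt => /orP[/eqP ->//|]; rewrite ltnS; exact: ts.
have [k kA] := task_surj A'.
have [|j n|X [finX bigX]] := @column_big_pseudo_intersection
  {s : seq K | forall i, i \in s -> lt i k} (fun s => seq_inter S (sval s)) A'
  (ndom k).
- by move=> m n mn t tn i im; apply: tn; exact: leq_trans im mn.
- by apply: qbig; exact: filterI.
have gX : exists X, good k S X.
  exists X; split=> [n|s sk]; first by rewrite kA.
  exact: (bigX (exist _ s sk)).
have [finS _] := xgetPex setT gX; rewrite -SE kA in finS.
exists (S k) => // n; apply: sub_finite_set (finS n) => t [tS nA]; split=> //.
by move=> /(_ n (leqnn n)).
Qed.

(** * Indexing the tasks by a well-order with small initial segments *)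

Lemma strict_well_order (W : eqType) : exists lt : W -> W -> Prop,
  [/\ well_founded lt, (forall x y z, lt x y -> lt y z -> lt x z) &
      (forall x y, [\/ lt x y, x = y | lt y x])].
Proof.
have [R woR] := well_ordering_principle W.
have minR (A : set W) : A !=set0 -> exists2 z, A z & forall x, A x -> R z x.
  move=> [a Aa]; have [|z [[zA lbz] _]] := woR (fun x => `[< A x >]).
    by exists a; apply/asboolP.
  by exists z => [|x Ax]; [exact/asboolP|apply: lbz; apply/asboolP].
(* Antisymmetry comes from the uniqueness of the least element of a two-point set. *)
have anti x y : R x y -> R y x -> x = y.
  move=> xy yx; pose A : {pred W} := [pred z | (z == x) || (z == y)].
  have [|z [_ uz]] := woR A; first by exists x; rewrite !inE eqxx.
  have refl w : R w w.
    have [|w' -> wR] := minR [set w]; first by exists w.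
    exact: wR.
  have zx : z = x.
    apply: uz; split; first by rewrite !inE eqxx.
    by move=> w; rewrite !inE => /orP[] /eqP ->.
  rewrite -zx; apply: uz; split; first by rewrite !inE eqxx orbT.
  by move=> w; rewrite !inE => /orP[] /eqP ->.
pose lt x y := ~ R y x.
have total x y : R x y \/ R y x.
  have [|z [->|->] zR] := minR [set x; y]; first by exists x; left.
    by left; apply: zR; right.
  by right; apply: zR; left.
exists lt; split.
- move=> x; apply: contrapT => nx.
  have [|z nz zmin] := minR [set x | ~ Acc lt x]; first by exists x.
  apply: nz; constructor => y yz; apply: contrapT => /zmin.
  exact: yz.
- move=> x y z xy yz zx.
  have {}xy' : R x y by have [|/xy] := total x y.
  have {}yz' : R y z by have [|/yz] := total y z.
  have [|w [[->|->]|->] wR] := minR ([set x; y] `|` [set z]).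
  + by exists x; left; left.
  + have xz : x = z by apply: anti zx; apply: wR; right.
    by apply: yz; rewrite -xz.
  + by apply: xy; apply: wR; left; left.
  + by apply: yz; apply: wR; left; right.
- move=> x y; have [->|xy] := pselect (x = y); first by constructor 2.
  have [yx|] := pselect (R y x); last by constructor 1.
  by constructor 3 => xy'; apply: xy; exact: anti.
Qed.

Section pairing.
Let W := nat -> bool.

Let z : W := fun=> false.

(** The bits of [x] and [y] are interleaved behind a leading [true], which tells pairs from [z]. *)
Let pair (x y : W) : W :=
  fun n => if n is n'.+1 then if odd n' then x n'./2 else y n'./2 else true.

Let pair_inj x y x' y' : pair x y = pair x' y' -> x = x' /\ y = y'.
Proof.
move=> e; split; apply/funext => n.
  have := congr1 (@^~ n.*2.+2) e.
  by rewrite /pair /= odd_double /= uphalf_double.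
have := congr1 (@^~ n.*2.+1) e.
by rewrite /pair odd_double /= half_double.
Qed.

Let pair_neq x y : pair x y <> z.
Proof. by move=> /(congr1 (@^~ 0%N)). Qed.

Inductive generated (B : set W) : W -> Prop :=
| generated_zero : generated B z
| generated_in x : B x -> generated B x
| generated_pair x y : generated B x -> generated B y ->
    generated B (pair x y).

Lemma generatedS (A B : set W) :
  A `<=` generated B -> generated A `<=` generated B.
Proof.
move=> AB x; elim=> [|y /AB //|? ? _ ? _ ?]; first exact: generated_zero.
exact: generated_pair.
Qed.

Lemma countable_generated (B : set W) :
  countable B -> countable (generated B).
Proof.
(* Level [n] consists of what is built from [z] and [B] by pairs nested at most [n] deep. *)
move=> cB; pose lev := fix lev n := if n is n'.+1 then
  lev n' `|` \bigcup_(x in lev n') (pair x @` lev n') else [set z] `|` B.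
have cU (A C : set W) : countable A -> countable C -> countable (A `|` C).
  by move=> cA cC; rewrite -bigcup2E; apply: bigcup_countable => // -[|[|n]].
have clev n : countable (lev n).
  elim: n => [|n IH] /=; first by apply: cU => //; exact: finite_set_countable.
  apply: (cU _ _ IH); apply: bigcup_countable => // x _.
  exact: sub_countable (card_image_le _ _) IH.
have lev_mono m n : (m <= n)%N -> lev m `<=` lev n.
  elim: n => [|n IH]; first by rewrite leqn0 => /eqP ->.
  by rewrite leq_eqVlt => /orP[/eqP ->//|/IH mn x /mn]; left.
apply: (@sub_countable _ _ _ (\bigcup_n lev n)); last exact: bigcup_countable.
apply: subset_card_le => x; elim.
- by exists 0%N => //; left.
- by move=> y By; exists 0%N => //; right.
- move=> u v _ [m _ um] _ [n _ vn]; exists (maxn m n).+1 => //; right.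
  exists u; first exact: lev_mono (leq_maxl _ _) _ um.
  by exists v => //; exact: lev_mono (leq_maxr _ _) _ vn.
Qed.

(** Folding a sequence with [pair] is injective, since no pair equals [z], and does not leave the
    generated points. *)
Lemma card_seq_generated (B : set W) (P : seq W -> Prop) :
  (forall s, P s -> forall x, x \in s -> generated B x) ->
  [set: {s | P s}] #<= generated B.
Proof.
move=> PB; pose code := foldr pair z.
have code_inj : injective code.
  elim=> [|x s IH] [|x' s'] //=; first by move/esym/pair_neq.
    by move/pair_neq.
  by move=> /pair_inj [-> /IH ->].
have inj : {in [set: {s | P s}] &, injective (fun s => code (sval s))}.
  move=> s s' _ _ /code_inj; case: s s' => s Ps [s' Ps'] /= e.
  exact: eq_exist.
rewrite -(card_le_eql (inj_card_eq inj)).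
apply: subset_card_le => _ [[s Ps] _ <-] /=.
elim: s {Ps}(PB _ Ps) => [|x s IH] sB /=; first exact: generated_zero.
apply: generated_pair; first by apply: sB; rewrite mem_head.
by apply: IH => y ys; apply: sB; rewrite inE ys orbT.
Qed.

Lemma uncountable_cantor : ~ countable [set: nat -> bool].
Proof.
move=> /countable_injP [f f_inj].
pose w n := `[< exists2 u : nat -> bool, f u = n & ~~ u n >].
have [ww|/asboolP nw] := boolP (w (f w)).
  have /asboolP [u fu nu] := ww.
  by move: nu; rewrite (f_inj u w) ?inE // ww.
by apply: (nw); exists w => //; apply/negP => /asboolP.
Qed.

(* The countable parameter [C] makes the negation of [fat] stable under the
   addition of a point. *)
Let fat (B : set W) :=
  exists2 C, countable C & [set: W] #<= generated (B `|` C).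

(* Well-order the reals; if some initial segment generates continuum many
   reals, cut at the least such segment. The closure under [pair] makes the
   finite sequences of generated points no more numerous than the generated
   points themselves. *)
Lemma task_order : d_eq_c ->
  exists (K : eqType) (lt : K -> K -> Prop)
         (task : K -> nat -> set (nat * nat)),
  [/\ well_founded lt, (forall x y z, lt x y -> lt y z -> lt x z),
      (forall x y, [\/ lt x y, x = y | lt y x]),
      (forall A, exists k, task k = A) &
      (forall k (f : {s : seq K | forall i, i \in s -> lt i k} -> nat -> nat),
        ~ dominating_family (range f))].
Proof.
move=> [_ dc].
have [wlt [wf tr tot]] := strict_well_order W.
pose seg a := [set x | wlt x a].
have wmin (A : set W) : A !=set0 -> exists2 a, A a & forall b, wlt b a -> ~ A b.
  move=> [a Aa]; apply: contrapT => nmin.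
  elim/(well_founded_ind wf): a Aa => a IH Aa.
  by apply: nmin; exists a => // b ba /(IH b ba).
(* [L] is the least fat initial segment, or everything if none is fat. It is nonempty because a
   countable set generates only countably many points. *)
have [L [C [cC KW [a0 La0] Lthin]]] : exists (L C : set W),
    [/\ countable C, [set: W] #<= generated (L `|` C), L !=set0 &
        (forall b, L b -> ~ fat (seg b))].
  have [/wmin [a [C cC hC] amin]|nfat] := pselect (exists a, fat (seg a)).
    exists (seg a), C; split=> //; apply/set0P/negP => /eqP sega.
    apply: uncountable_cantor; apply: sub_countable hC _.
    by apply: countable_generated; rewrite sega set0U.
  exists [set: W], set0; split=> //.
  - by apply: subset_card_le => x _; apply: generated_in; left.
  - by exists z.
  - by move=> b _ fb; apply: nfat; exists b.
pose loc b := seg b `|` ([set b] `|` C).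
have loc_mono b b' : wlt b b' \/ b = b' ->
    generated (loc b) `<=` generated (loc b').
  move=> [bb'|-> //]; apply: generatedS => x [xb|[->|Cx]]; apply: generated_in.
  - by left; exact: tr xb bb'.
  - by left.
  - by right; right.
(* A point is built from finitely many generators, and the largest one in [L] bounds the others. *)
have rankP x : generated (L `|` C) x -> exists2 b, L b & generated (loc b) x.
  elim=> [|{}x [Lx|Cx]|u v _ [b Lb bu] _ [b' Lb' bv]].
  - by exists a0 => //; exact: generated_zero.
  - by exists x => //; apply: generated_in; right; left.
  - by exists a0 => //; apply: generated_in; right; right.
  - have [bb'|bb'|bb'] := tot b b'.
    + exists b' => //; apply: generated_pair bv.
      by apply: loc_mono bu; left.
    + exists b' => //; apply: generated_pair bv.
      by apply: loc_mono bu; right.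
    + exists b => //; apply: generated_pair bu _.
      by apply: loc_mono bv; left.
pose K := set_type (generated (L `|` C)).
have /choice[rk rkP] (k : K) : exists b, L b /\ generated (loc b) (val k).
  by have [b] := rankP _ (set_valP k); exists b.
(* Comparing ranks first ensures that all predecessors of [k] are generated by [loc (rk k)]. *)
pose lt (k k' : K) :=
  wlt (rk k) (rk k') \/ (rk k = rk k' /\ wlt (val k) (val k')).
have [f [fK f_inj]] : exists f : W -> W,
    (forall w, generated (L `|` C) (f w)) /\ injective f.
  have [f] := card_leP KW; exists (fun w => val (f (to_setT w))).
  split=> [w|w w' /val_inj e]; first exact: set_valP.
  have /(congr1 val) : to_setT w = to_setT w'; last by [].
  by apply: 'inj_f e; rewrite inE.
pose decode (w : W) : nat -> set (nat * nat) :=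
  fun n => [set t | w (pickle (n, t))].
exists K, lt, (fun k => decode (xget z [set w | f w = val k])); split.
- suff acc b k : rk k = b -> Acc lt k by move=> k; exact: acc erefl.
  elim/(well_founded_ind wf): b k => b IHb k; move: {-1}(val k) (erefl (val k)).
  move=> x; elim/(well_founded_ind wf): x k => x IHx k kx kb.
  constructor => k' [k'k|[k'k vk]].
    by apply: (IHb (rk k')) => //; rewrite -kb.
  by apply: (IHx (val k')) => //; [rewrite -kx|rewrite k'k].
- move=> x y t [xy|[xy vxy]] [yt|[yt vyt]].
  + by left; exact: tr xy yt.
  + by left; rewrite -yt.
  + by left; rewrite xy.
  + by right; rewrite xy; split=> //; exact: tr vxy vyt.
- move=> x y; have [xy|xy|xy] := tot (rk x) (rk y).
  + by constructor 1; left.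
  + have [vxy|vxy|vxy] := tot (val x) (val y).
    * by constructor 1; right.
    * by constructor 2; exact: val_inj.
    * by constructor 3; right.
  + by constructor 3; left.
- move=> A; pose w : W := fun m =>
    if unpickle m is Some (n, t) then `[< A n t >] else false.
  exists (SigSub (mem_set (fK w))) => /=.
  have /f_inj -> : f (xget z [set v | f v = f w]) = f w.
    by apply: (@xgetPex _ z [set v | f v = f w]); exists w.
  apply/funext => n; apply/seteqP; split=> t;
    by rewrite /decode /w /= pickleK => /asboolP.
(* A dominating family indexed by sequences below [k] would inject the continuum into the points
   generated by [loc (rk k)], making the segment at [rk k] fat. *)
- move=> k g /dc hg; have [Lb _] := rkP k; apply: (Lthin _ Lb).
  exists ([set rk k] `|` C).
    by rewrite -bigcup2E; apply: bigcup_countable => // -[|[|n]] _ //=.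
  apply: card_le_trans hg _; apply: card_le_trans (card_image_le _ _) _.
  pose P (s : seq W) := forall x, x \in s -> generated (loc (rk k)) x.
  apply: card_le_trans (card_seq_generated (P := P) _); last by [].
  have sP (s : {s : seq K | forall i, i \in s -> lt i k}) :
      P [seq val i | i <- sval s].
    move=> _ /mapP [i /(svalP s) ik ->]; have [_] := rkP i; apply: loc_mono.
    by case: ik => [|[]]; [left|right].
  have s_inj : injective (fun s => exist P _ (sP s)).
    move=> [s sk] [s' s'k] /(congr1 sval) /= /(inj_map val_inj) e.
    exact: eq_exist.
  rewrite -(card_le_eql (inj_card_eq (in2W s_inj))).
  exact: subset_card_le.
Qed.

End pairing.

Lemma exists_column_big_p_point : d_eq_c ->
  exists q : set_system (nat * nat),
    [/\ UltraFilter q, p_point q & forall X, q X -> column_big X].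
Proof.
move=> /task_order [K [lt [task [wf tr tot surj ndom]]]].
exact: p_point_from_index wf tr tot surj ndom.
Qed.

(** * Homeomorphisms of products *)

Lemma ultra_fmap (T T' : Type) (f : T -> T') (q : set_system T) :
  UltraFilter q -> UltraFilter (f @ q).
Proof.
move=> Uq; split=> [|G PG qG]; first exact: fmap_proper_filter.
apply/seteqP; split=> [A GA|]; last exact: qG.
have [//|qC] := in_ultra_setVsetC (f @^-1` A) Uq.
have GC : G (~` A) by exact: qG.
by have [z []] := filter_ex (filterI GA GC).
Qed.

(** Each point is picked in the intersection of the sets [D t] over the points [t] picked before. *)
Lemma filter_diagonal_sequence (T : Type) (p : set_system T)
    (D : T -> set T) :
  ProperFilter p -> (forall t, p (D t)) ->
  exists s : nat -> T, forall i l, (i < l)%N -> D (s i) (s l).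
Proof.
move=> pp pD; have pick (A : {A | p A}) : exists t, sval A t.
  by case: A => A pA; have [t At] := filter_ex pA; exists t.
have [x xP] := choice pick.
have nextP (A : {A | p A}) : p (sval A `&` D (x A)).
  by apply: filterI => //; exact: svalP.
pose next (A : {A | p A}) : {A | p A} := exist _ _ (nextP A).
have pT : p setT by exact: filterT.
pose A n := iter n next (exist _ setT pT).
have A_decr m n : (m <= n)%N -> sval (A n) `<=` sval (A m).
  elim: n => [|n IH]; first by rewrite leqn0 => /eqP ->.
  by rewrite leq_eqVlt => /orP[/eqP -> //|/IH]; apply: subset_trans => t [].
exists (x \o A) => i l il.
by have [] := A_decr _ _ il _ (xP (A l)).
Qed.

Section combine.
Variables (I : Type) (X : I -> topologicalType).

Definition combine (P : I -> Prop) (a c : prod_topology X) : prod_topology X :=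
  fun j => if pselect (P j) then a j else c j.

Lemma combine_cvg_r (T : Type) (F : set_system T) (P : I -> Prop)
    (a : prod_topology X) (c : T -> prod_topology X) (c' : prod_topology X) :
  Filter F -> c @ F --> c' ->
  (fun t => combine P a (c t)) @ F --> combine P a c'.
Proof.
move=> FF /cvg_prodP cc'; apply/cvg_prodP => j.
by rewrite /combine; case: pselect => Pj; [exact: cvg_cst|exact: cc'].
Qed.

(** At each coordinate the ultrafilter decides which of the two arguments is used on a large set of
    [t]. *)
Lemma combine_cvg_l (T : Type) (F : set_system T) (P : T -> I -> Prop)
    (a : T -> prod_topology X) (a' c : prod_topology X) :
  UltraFilter F -> a @ F --> a' ->
  (fun t => combine (P t) (a t) c) @ F -->
    combine (fun j => F [set t | P t j]) a' c.
Proof.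
move=> UF /cvg_prodP aa'; apply/cvg_prodP => j; move: {aa'}(aa' j).
rewrite /combine; case: pselect => FP aa'.
  apply: (cvg_eq_near (g := fun t => a t j) _ _ aa').
  by apply: filterS FP => t Pt /=; case: pselect.
apply: near_cst_cvg; have [//|] := in_ultra_setVsetC [set t | P t j] UF.
by apply: filterS => t nPt /=; case: pselect.
Qed.

Lemma combine_self (a c : prod_topology X) :
  combine (fun j => a j <> c j) a c = a.
Proof.
apply: functional_extensionality_dep => j; rewrite /combine.
by case: pselect => [//|n] /=; rewrite (contrapT n).
Qed.

Lemma combine_false (P : I -> Prop) (a c : prod_topology X) :
  (forall j, ~ P j) -> combine P a c = c.
Proof.
move=> nP; apply: functional_extensionality_dep => j; rewrite /combine.
by case: pselect => // Pj; case: (nP j).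
Qed.

(* On the points [v m = h (e m)], let [u m k] agree with [v m] where [v m]
   differs from [y], and with [v k] elsewhere. Then [g (u m k) i0] tends to
   [e m i0] as [k] varies and to [e k i0] as [m] varies, while its iterated
   limits agree: this contradicts the beta-omega property of [X i0]. *)
Lemma homeomorphism_coordinates_not_eq_limit (i0 : I) (p : set_system nat)
    (h g : prod_topology X -> prod_topology X) (e : nat -> prod_topology X)
    (y : prod_topology X) (W : nat -> set (X i0)) :
  UltraFilter p -> (forall N, p [set m | (N <= m)%N]) ->
  (forall j, compact [set: X j]) -> hausdorff_space (X i0) ->
  beta_omega_space (X i0) ->
  continuous g -> cancel h g ->
  (forall m, open_nbhs (e m i0) (W m)) ->
  (forall m n, m <> n -> W m `&` W n = set0) ->
  (h \o e) @ p --> y ->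
  ~ (forall j, p [set m | h (e m) j = y j]).
Proof.
move=> Up p_ge cX hX bX cg hK We W0 vy v_eq.
pose v m := h (e m); pose gam f := g f i0.
have gam_cvg (f : nat -> prod_topology X) (l : prod_topology X) :
    f @ p --> l -> (gam \o f) @ p --> gam l.
  move=> fl; have gfl : (g \o f) @ p --> g l by apply: cvg_comp fl _; exact: cg.
  by move/cvg_prodP : gfl => /(_ i0).
pose P m j := v m j <> y j.
pose u m k := combine (P m) (v m) (v k).
have /choice[V VP] (m : nat) : exists V, open_nbhs (e m i0) V /\
    closure V `<=` W m.
  have [oW Wm] := We m.
  by have [V] := compact_shrink_open (cX i0) hX oW Wm; exists V.
have gam_v m : gam (v m) = e m i0 by rewrite /gam /v hK.
(* As [k] varies, [v k] tends to [y], and [v m] with [y] filled in where they agree is [v m]. *)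
have row m : p [set k | V m (gam (u m k))].
  have ul : (fun k => u m k) @ p --> combine (P m) (v m) y.
    exact: combine_cvg_r.
  rewrite combine_self in ul; have gl := gam_cvg _ _ ul.
  by rewrite gam_v in gl; exact: (gl _ (open_nbhs_nbhs (VP m).1)).
(* As [k] varies, [v k] equals [y] at each fixed coordinate for [p]-many [k], so nothing of it
   survives in the limit. *)
have col m : p [set k | V m (gam (u k m))].
  have ul : (fun k => u k m) @ p -->
      combine (fun j => p [set t | P t j]) y (v m).
    exact: combine_cvg_l.
  rewrite combine_false in ul; last first.
    by move=> j pj; have [t []] := filter_ex (filterI pj (v_eq j)).
  have gl := gam_cvg _ _ ul.
  by rewrite gam_v in gl; exact: (gl _ (open_nbhs_nbhs (VP m).1)).
pose D m := [set k | [/\ (m < k)%N, V m (gam (u m k)) & V m (gam (u k m))]].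
have pD m : p (D m).
  by apply: filterS (filterI (p_ge m.+1) (filterI (row m) (col m))) => k [? []].
have [s sD] := filter_diagonal_sequence _ pD.
have s_lt i l : (i < l)%N -> (s i < s l)%N by move=> /sD [].
have s_inj i l : s i = s l -> i = l.
  move=> sil; have [/s_lt|/s_lt|//] := ltngtP i l; by rewrite sil ltnn.
pose a i := v (s i.*2); pose c l := v (s l.*2.+1).
have lim (f : nat -> prod_topology X) : exists l : prod_topology X, f @ p --> l.
  have fl j := ultra_cvg_compact (fun m => f m j) Up (cX j).
  exists (fun j => projT1 (cid (fl j))); apply/cvg_prodP => j.
  exact: projT2 (cid (fl j)).
have [a' aa'] := lim a; have [c' cc'] := lim c.
(* From here [p] serves as a free ultrafilter on the positions [i] and [l] in the subsequence.
   [alpha] takes the limit over [l] first, [beta] over [i] first, and [w] is the common iterated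
   limit. *)
pose P' j := p [set i | P (s i.*2) j].
pose alpha i := gam (combine (P (s i.*2)) (a i) c').
pose beta l := gam (combine P' a' (c l)).
pose w := gam (combine P' a' c').
have alpha_w : alpha @ p --> w by apply: gam_cvg; exact: combine_cvg_l.
have beta_w : beta @ p --> w by apply: gam_cvg; exact: combine_cvg_r.
have alphaW i : W (s i.*2) (alpha i).
  apply: (VP _).2.
  have lim_l : (fun l => gam (u (s i.*2) (s l.*2.+1))) @ p --> alpha i.
    by apply: gam_cvg; exact: combine_cvg_r.
  apply: closureS (cvg_closure _ (p_ge i) lim_l) => _ [l il <-].
  by have [] := sD i.*2 l.*2.+1; first by rewrite ltnS leq_double.
have betaW l : W (s l.*2.+1) (beta l).
  apply: (VP _).2.
  have lim_i : (fun i => gam (u (s i.*2) (s l.*2.+1))) @ p --> beta l.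
    by apply: gam_cvg; exact: combine_cvg_l.
  apply: closureS (cvg_closure _ (p_ge l.+1) lim_i) => _ [i li <-].
  by have [] := sD l.*2.+1 i.*2; first by rewrite -doubleS leq_double.
(* Interleaving matches the [n]-th value with the [n]-th of the disjoint sets [W (s n)]. *)
pose E n := if odd n then beta n./2 else alpha n./2.
have EW n : W (s n) (E n).
  rewrite /E -[in s n](odd_double_half n); case: (odd n) => /=.
    by rewrite add1n; exact: betaW.
  by rewrite add0n; exact: alphaW.
have E_eq m n : W (s m) (E n) -> m = n.
  move=> Wmn; apply: contrapT => mn.
  by have : (W (s m) `&` W (s n)) (E n) by []; rewrite W0 // => /s_inj.
have alphaE i : alpha i = E i.*2 by rewrite /E odd_double doubleK.
have betaE l : beta l = E l.*2.+1.
  by rewrite /E /= odd_double /= uphalf_double.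
have AE : range alpha `|` range beta `<=` range E.
  move=> _ [] [i _ <-]; first by rewrite alphaE; exists i.*2.
  by rewrite betaE; exists i.*2.+1.
have cl0 : closure (range alpha) `&` closure (range beta) = set0.
  apply: beta_omega_disjoint_closures => //.
  - apply: sub_countable (subset_card_le AE) _.
    exact: sub_countable (card_image_le _ _) (countableP _).
  - apply: isolated_discrete_subset => z /AE [n _ <-].
    exists (W (s n)); first by have [oW _] := We (s n).
    by move=> z' [Wz /AE [m _ mz]]; rewrite -mz in Wz *; rewrite (E_eq _ _ Wz).
  - apply/seteqP; split=> // _ [[i _ <-] [l _]].
    rewrite alphaE betaE => El; have := EW i.*2; rewrite -El => /E_eq.
    by move=> /(congr1 odd); rewrite /= !odd_double.
have : (closure (range alpha) `&` closure (range beta)) w.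
  have pT : p setT by exact: filterT.
  by split; [exact: cvg_closure pT alpha_w|exact: cvg_closure pT beta_w].
by rewrite cl0.
Qed.

End combine.

Theorem corollary11 (dc : d_eq_c) (I : Type) (I_nonempty : inhabited I)
    (X : I -> topologicalType)
    (X_tychonoff : forall i : I, tychonoff_space (X i))
    (X_infinite : forall i : I, infinite_set [set: X i])
    (X_compact : forall i : I, compact [set: X i])
    (X_beta_omega : forall i : I, beta_omega_space (X i)) :
  ~ homogeneous_space (prod_topology X).
Proof.
move=> hom; case: I_nonempty => i0.
have hX i : hausdorff_space (X i) by case: (X_tychonoff i).
have [q [Uq qP qbig]] := exists_column_big_p_point dc.
pose p := fst @ q; have Up : UltraFilter p by exact: ultra_fmap.
have seqX i : exists d : nat -> X i, injective d /\ exists W : nat -> set (X i),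
    (forall n, open_nbhs (d n) (W n)) /\
    (forall m n, m <> n -> W m `&` W n = set0).
  have [d [W [dW W0]]] := infinite_disjoint_opens (hX i) (X_infinite i).
  exists d; split; last by exists W.
  move=> m n dmn; apply: contrapT => /W0 Wmn.
  have : (W m `&` W n) (d m).
    by split; [|rewrite dmn]; case: (dW m); case: (dW n).
  by rewrite Wmn.
pose d i := projT1 (cid (seqX i)).
have [d_inj dW] : (forall i, injective (d i)) /\
  forall i, exists W : nat -> set (X i),
    (forall n, open_nbhs (d i n) (W n)) /\
    (forall m n, m <> n -> W m `&` W n = set0).
  by split=> i; rewrite /d; case: cid => f [].
(* [pickle] turns the sequence [d i] into an injective family on [nat * nat]. *)
have qlim i := ultra_cvg_compact (fun t : nat * nat => d i (pickle t)) Uq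
  (X_compact i).
have plim i := ultra_cvg_compact (d i) Up (X_compact i).
pose y : prod_topology X := fun i => projT1 (cid (qlim i)).
pose x : prod_topology X := fun i => projT1 (cid (plim i)).
have [h [ch [g [cg hK _]]] hxy] := hom x y.
pose e m : prod_topology X := fun i => d i m.
have ex : e @ p --> x by apply/cvg_prodP => i; exact: projT2 (cid (plim i)).
have hey : (h \o e) @ p --> y by rewrite -hxy; apply: cvg_comp ex _; exact: ch.
have p_ge N : p [set m | (N <= m)%N].
  have [//|/qbig /column_big_fst_ge /(_ N) [t]] :=
    in_ultra_setVsetC [set t | (N <= t.1)%N] Uq.
  by [].
have [W [We W0]] := dW i0.
apply: (homeomorphism_coordinates_not_eq_limit (i0 := i0) (e := e) Up p_ge
  X_compact (hX i0) (X_beta_omega i0) cg hK We W0 hey) => j.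
apply: (@p_point_cvg_eq_limit _ q fst (X j) (d j \o pickle)
  (fun m => h (e m) j)) => //.
(* A big set has points in columns beyond that of [t], so [q] is free. *)
- move=> t /qbig /column_big_fst_ge /(_ t.1.+1) [_ ->].
  by rewrite ltnn.
- by move=> R; exact: column_big_ultra_avoid.
- by apply: inj_comp (d_inj j) _; exact: (pcan_inj pickleK).
- exact: projT2 (cid (qlim j)).
- by move/cvg_prodP : hey => /(_ j).
Qed.
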